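(* Let $G$ be a finite group with $G/Z(G)\cong D_{2m}$, $m\ge3$, and $z=|Z(G)|$. Then: (1) $\Gamma_G$ is borderenergetic if $m=3$ and $z=1$; (2) $\Gamma_G$ is not hyperenergetic; (3) $\Gamma_G$ is L-borderenergetic if $m=3$ and $z=1$; (4) $\Gamma_G$ is L-hyperenergetic unless $z=1$, or $m=3$, or $(m,z)=(5,2)$ (in these cases it is not L-hyperenergetic); (5) $\Gamma_G$ is Q-borderenergetic if $m=3$ and $z=1$; (6) $\Gamma_G$ is Q-hyperenergetic unless $z=1$, or $m=3$, or $(m,z)\in\{(5,2),(4,2)\}$ (in these cases it is not Q-hyperenergetic).
   Context: $D_{2m}=\langle x,y\mid x^m=y^2=1,\ yxy^{-1}=x^{-1}\rangle$. The NCCC-graph $\Gamma_G$ of a finite non-abelian group $G$ with center $Z(G)$ has vertex set $\{x^G: x\in G\setminus Z(G)\}$ ($x^G$ the conjugacy class of $x$), distinct vertices $x^G,y^G$ adjacent iff $x'y'\neq y'x'$ for all $x'\in x^G,y'\in y^G$. For a simple graph $\mathcal G$ with adjacency matrix $A$, degree matrix $D$, $L=D-A$, $Q=D+A$: $E(\mathcal G)=\sum|\lambda|$ over eigenvalues of $A$; with $\Delta=2|E(\mathcal G)|/|V(\mathcal G)|$, $LE(\mathcal G)=\sum|\beta-\Delta|$ over eigenvalues of $L$, $SE(\mathcal G)=\sum|\gamma-\Delta|$ over eigenvalues of $Q$ (with multiplicity). For $N=|V(\mathcal G)|$, $E(K_N)=LE(K_N)=SE(K_N)=2(N-1)$. $\mathcal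 G$ is hyperenergetic if $E(\mathcal G)>E(K_N)$ and borderenergetic if $E(\mathcal G)=E(K_N)$; L-hyperenergetic/L-borderenergetic and Q-hyperenergetic/Q-borderenergetic are defined analogously with $LE$ and $SE$. *)

(* Defs.v *)
From HB Require Import structures.
From mathcomp Require Import all_boot all_order all_algebra all_fingroup all_solvable.
From mathcomp Require Import all_field.
Set Implicit Arguments. Unset Strict Implicit. Unset Printing Implicit Defensive.
Import Order.TTheory GRing.Theory Num.Theory.
Local Open Scope ring_scope.

Section GraphEnergy.
Variables (T : finType) (e : rel T).

Definition adjmx : 'M[algC]_#|T| :=
  \matrix_(i, j) (e (enum_val i) (enum_val j))%:R.

Definition gdeg (v : T) : nat := #|[set w | e v w]|.

Definition degmx : 'M[algC]_#|T| :=
  \matrix_(i, j) ((i == j)%:R * (gdeg (enum_val i))%:R).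

Definition lapmx : 'M[algC]_#|T| := degmx - adjmx.
Definition slapmx : 'M[algC]_#|T| := degmx + adjmx.

Definition nedges : nat :=
  #|[set E : {set T} | [exists v, exists w, (v != w) && e v w && (E == [set v; w])]]|.

Definition avgdeg : algC := (2 * nedges)%:R / #|T|%:R.
End GraphEnergy.

(* eigenvalues (with multiplicity) of a square complex matrix: the roots of its
   characteristic polynomial, listed with multiplicity *)
Definition spectrum n (M : 'M[algC]_n) : seq algC :=
  sval (closed_field_poly_normal (char_poly M)).

Definition energy (T : finType) (e : rel T) : algC :=
  \sum_(l <- spectrum (adjmx e)) `|l|.
Definition Lenergy (T : finType) (e : rel T) : algC :=
  \sum_(l <- spectrum (lapmx e)) `|l - avgdeg e|.
Definition Qenergy (T : finType) (e : rel T) : algC :=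
  \sum_(l <- spectrum (slapmx e)) `|l - avgdeg e|.

(* energy of the complete graph K_N, i.e. 2(N-1) with N = |V| *)
Definition EK (T : finType) : algC := 2%:R * (#|T|.-1)%:R.

Definition hyperenergetic (T : finType) (e : rel T) := EK T < energy e.
Definition borderenergetic (T : finType) (e : rel T) := energy e = EK T.
Definition L_hyperenergetic (T : finType) (e : rel T) := EK T < Lenergy e.
Definition L_borderenergetic (T : finType) (e : rel T) := Lenergy e = EK T.
Definition Q_hyperenergetic (T : finType) (e : rel T) := EK T < Qenergy e.
Definition Q_borderenergetic (T : finType) (e : rel T) := Qenergy e = EK T.

Section NCCC.
Variables (gT : finGroupType) (G : {group gT}).

Definition nccc_vset : {set {set gT}} :=
  [set C | [exists x in (G :\: 'Z(G))%g, C == (x ^: G)%g]].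

Definition nccc_vertex := {C : {set gT} | C \in nccc_vset}.

Definition nccc_adj : rel nccc_vertex :=
  fun C D => (C != D) &&
    [forall x in val C, forall y in val D, (x * y != y * x)%g].
End NCCC.

(* Main.v *)
(* Let [A] be the preimage in [G] of the rotation subgroup of [G / 'Z(G)]; it is
   abelian of index 2.  Noncentral classes inside [A] have size 2 and pairwise
   commute, no noncentral element of [A] commutes with an element outside [A],
   and two classes outside [A] (all of size [m]) contain commuting elements iff
   they have the same image in [G / 'Z(G)].  The reflections of [G / 'Z(G)] form
   one class if [m] is odd and two if [m] is even, so with [z] the order of the
   center the graph is the complete multipartite graph K_{(m-1)z/2, z} (m odd) or
   K_{(m-1)z/2, z/2, z/2} (m even).  Its three matrices are constant on blocks up
   to a diagonal that is constant on blocks, so their spectra come from quotient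
   matrices of size 2 or 3, and the claims become inequalities in [m] and [z]. *)

Require Import Defs.
From HB Require Import structures.
From mathcomp Require Import all_boot all_order all_algebra all_fingroup all_solvable.
From mathcomp Require Import all_field.
From mathcomp Require Import ring zify.
Import Order.TTheory GRing.Theory Num.Theory.
Local Open Scope ring_scope.

(* The matrix is [D + U C U^T] with [U] the block incidence matrix.  Both factors
   on the two sides are obtained by block-triangularizing the same matrix
   [['X - D, U], [C U^T, 1]], because ['X - D] commutes with [U].  The extra
   product on the left avoids dividing by ['X - D]. *)
Lemma char_poly_blockwise_constant (R : comNzRingType) (n k : nat)
    (f : 'I_n -> 'I_k) (d : 'I_k -> R) (C : 'M[R]_k) :
  char_poly (\matrix_(i, j) ((i == j)%:R * d (f i) + C (f i) (f j)))
    * \prod_p ('X - (d p)%:P)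
  = (\prod_i ('X - (d (f i))%:P))
    * char_poly (\matrix_(p, q)
        ((p == q)%:R * d p + C p q * #|[set i | f i == q]|%:R)).
Proof.
pose E : 'M[{poly R}]_n := diag_mx (\row_i ('X - (d (f i))%:P)).
pose Ek : 'M[{poly R}]_k := diag_mx (\row_p ('X - (d p)%:P)).
pose U : 'M[{poly R}]_(n, k) := \matrix_(i, p) (f i == p)%:R.
pose W : 'M[{poly R}]_(k, n) := \matrix_(p, j) (C p (f j))%:P.
have EUW : char_poly_mx (\matrix_(i, j)
    ((i == j)%:R * d (f i) + C (f i) (f j))) = E - U *m W.
  apply/matrixP => i j; rewrite !mxE (bigD1 (f i)) //= big1 => [|p npi].
    rewrite !mxE eqxx mul1r addr0 polyCD opprD addrA; congr (_ - _).
    by case: eqP => _; rewrite !(mul1r, mul0r, mulr1n, mulr0n) ?subr0 ?subrr.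
  by rewrite !mxE eq_sym (negPf npi) mul0r.
have EWU : char_poly_mx (\matrix_(p, q)
    ((p == q)%:R * d p + C p q * #|[set i | f i == q]|%:R)) = Ek - W *m U.
  apply/matrixP => p q; rewrite !mxE polyCD opprD addrA; congr (_ - _).
    by case: eqP => _; rewrite !(mul1r, mul0r, mulr1n, mulr0n) ?subr0 ?subrr.
  rewrite (bigID (fun i => f i == q)) /= [X in _ + X]big1 => [|i nfi]; last first.
    by rewrite !mxE (negPf nfi) mulr0.
  rewrite addr0 (eq_bigr (fun=> (C p q)%:P)) => [|i /eqP fi]; last first.
    by rewrite !mxE fi eqxx mulr1.
  rewrite sumr_const polyCM polyC_natr mulr_natr; congr (_ *+ _).
  by apply: eq_card => i; rewrite inE.
have EU : E *m U = U *m Ek.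
  apply/matrixP => i p; rewrite mul_diag_mx mul_mx_diag !mxE.
  by case: eqP => [<-|_]; rewrite ?mul1r ?mulr1 ?mul0r ?mulr0.
rewrite /char_poly EUW EWU.
have <- : \det Ek = \prod_p ('X - (d p)%:P).
  by rewrite det_diag; apply: eq_bigr => p _; rewrite mxE.
have <- : \det E = \prod_i ('X - (d (f i))%:P).
  by rewrite det_diag; apply: eq_bigr => p _; rewrite mxE.
have B1 : block_mx E U W 1%:M *m block_mx 1%:M 0 (- W) 1%:M
    = block_mx (E - U *m W) U 0 1%:M.
  by rewrite mulmx_block !(mulmx1, mul1mx, mulmxN, mulmx0, add0r, subrr).
have B2 : block_mx E U W 1%:M *m block_mx 1%:M (- U) 0 Ek
    = block_mx E 0 W (Ek - W *m U).
  rewrite mulmx_block !(mulmx1, mul1mx, mulmxN, mulmx0, addr0) EU addNr.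
  by rewrite addrC.
move: (congr1 determinant B1) (congr1 determinant B2).
rewrite !det_mulmx !det_ublock !det_lblock !det1 !(mulr1, mul1r) => ->.
by rewrite -/E -/Ek.
Qed.

Lemma char_poly_spectrum n (M : 'M[algC]_n) :
  char_poly M = \prod_(l <- spectrum M) ('X - l%:P).
Proof.
rewrite /spectrum; case: closed_field_poly_normal => s /= Hs.
by rewrite {1}Hs (monicP (char_poly_monic M)) scale1r.
Qed.

Lemma spectrum_blockwise_constant (n k : nat) (f : 'I_n -> 'I_k)
    (d : 'I_k -> algC) (C : 'M[algC]_k) (s : seq algC) (F : algC -> algC) :
  char_poly (\matrix_(p, q)
      ((p == q)%:R * d p + C p q * #|[set i | f i == q]|%:R))
    = \prod_(l <- s) ('X - l%:P) ->
  \sum_(l <- spectrum (\matrix_(i, j)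
      ((i == j)%:R * d (f i) + C (f i) (f j)))) F l
  = \sum_p (#|[set i | f i == p]|%:R - 1) * F (d p) + \sum_(l <- s) F l.
Proof.
move=> Hs; set M := \matrix_(i, j) _.
have := char_poly_blockwise_constant _ _ _ f d C.
rewrite Hs -/M char_poly_spectrum.
have tomap m (g : 'I_m -> algC) : \prod_i ('X - (g i)%:P)
    = \prod_(l <- [seq g i | i : 'I_m]) ('X - l%:P).
  by rewrite /image_mem big_map enumT.
have tosum m (g : 'I_m -> algC) :
    \sum_(l <- [seq g i | i : 'I_m]) F l = \sum_i F (g i).
  by rewrite /image_mem big_map enumT.
rewrite (tomap _ d) (tomap _ (d \o f)) -!big_cat /=.
move/prod_XsubC_eq => pe.
have := perm_big (op := +%R) (x := 0) _ pe (P := xpredT) (F := F).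
rewrite !big_cat /= (tosum _ d) (tosum _ (d \o f)) => /(canRL (addrK _)) ->.
rewrite addrAC; congr (_ + _).
rewrite (partition_big f predT) //= -sumrB; apply: eq_bigr => p _.
rewrite (eq_bigr (fun=> F (d p))) => [|i /eqP -> //].
rewrite sumr_const mulrBl mul1r mulr_natl; congr (_ *+ _ - _).
by apply: eq_card => i; rewrite !inE.
Qed.

Lemma handshake (T : finType) (e : rel T) :
  symmetric e -> irreflexive e -> (2 * nedges e)%N = (\sum_v gdeg e v)%N.
Proof.
move=> esym eirr; pose P := [set u : T * T | e u.1 u.2].
have -> : (\sum_v gdeg e v)%N = #|P|.
  rewrite -sum1_card (eq_bigr (fun v => \sum_(w | e v w) 1)%N) => [|v _].
    by rewrite pair_big_dep /=; apply: eq_bigl => -[v w]; rewrite inE.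
  by rewrite /gdeg -sum1_card; apply: eq_bigl => w; rewrite inE.
rewrite -sum1_card (partition_big (fun u => [set u.1; u.2])
  [in [set E : {set T} | [exists v, exists w,
     (v != w) && e v w && (E == [set v; w])]]]) /=; last first.
  move=> [v w]; rewrite !inE /= => evw; apply/existsP; exists v.
  apply/existsP; exists w; rewrite evw eqxx !andbT.
  by apply: contraTneq evw => ->; rewrite eirr.
rewrite mulnC /nedges -sum_nat_const; apply: eq_bigr => E.
rewrite inE => /existsP[v /existsP[w /andP[/andP[nvw evw] /eqP->]]].
rewrite sum1_card; symmetry.
transitivity #|[set (v, w); (w, v)]|; last first.
  by rewrite cards2 xpair_eqE negb_and nvw.
apply: eq_card => -[x y]; rewrite !inE unfold_in /= !xpair_eqE.
apply/andP/orP => [[exy /eqP Exy]|[]/andP[/eqP-> /eqP->]]; last 2 first.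
- by rewrite inE eqxx.
- by rewrite inE /= esym setUC eqxx.
have nxy : x != y by apply: contraTneq exy => ->; rewrite inE /= eirr.
have /set2P xvw : x \in [set v; w] by rewrite -Exy set21.
have /set2P yvw : y \in [set v; w] by rewrite -Exy set22.
by case: xvw yvw nxy => -> [] ->; rewrite ?eqxx //; [left | right].
Qed.

Lemma gdeg_multipartite (T : finType) (e : rel T) k (f : T -> 'I_k)
    (n : 'I_k -> nat) v :
  (forall v w, e v w = (f v != f w)) ->
  (forall p, #|[set v | f v == p]| = n p) ->
  (gdeg e v)%:R = #|T|%:R - (n (f v))%:R :> algC.
Proof.
move=> ef nf; apply: (canRL (addrK _)).
rewrite -cardsT -(cardsID [set w | f w == f v] [set: T]) setTI nf natrD addrC.
congr (_ + _); congr _%:R; apply: eq_card => w.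
by rewrite !inE andbT ef eq_sym.
Qed.

Lemma avgdeg_multipartite (T : finType) (e : rel T) k (f : T -> 'I_k)
    (n : 'I_k -> nat) :
  (forall v w, e v w = (f v != f w)) ->
  (forall p, #|[set v | f v == p]| = n p) ->
  avgdeg e = (\sum_p (n p)%:R * (#|T|%:R - (n p)%:R)) / #|T|%:R.
Proof.
move=> ef nf; rewrite /avgdeg handshake => [|v w|v]; last 2 first.
- by rewrite !ef eq_sym.
- by rewrite ef eqxx.
congr (_ / _); rewrite natr_sum (partition_big f predT) //=.
apply: eq_bigr => p _; rewrite (eq_bigr (fun=> #|T|%:R - (n p)%:R)) => [|v].
  rewrite sumr_const mulr_natl -nf; congr (_ *+ _).
  by apply: eq_card => v; rewrite !inE.
by move/eqP <-; exact: gdeg_multipartite ef nf.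
Qed.

Lemma spectrum_multipartite (T : finType) (e : rel T) k (f : T -> 'I_k)
    (n : 'I_k -> nat) (d : 'I_k -> algC) (eps : algC)
    (s : seq algC) (F : algC -> algC) (M : 'M[algC]_#|T|) :
  (forall v w, e v w = (f v != f w)) ->
  (forall p, #|[set v | f v == p]| = n p) ->
  (forall i j, M i j = (i == j)%:R * d (f (enum_val i))
                       + eps * (e (enum_val i) (enum_val j))%:R) ->
  char_poly (\matrix_(p, q)
      ((p == q)%:R * d p + eps * (p != q)%:R * (n q)%:R))
    = \prod_(l <- s) ('X - l%:P) ->
  \sum_(l <- spectrum M) F l
    = \sum_p ((n p)%:R - 1) * F (d p) + \sum_(l <- s) F l.
Proof.
move=> ef nf defM Hs.
have nf' p : #|[set i : 'I_#|T| | f (enum_val i) == p]| = n p.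
  rewrite -nf -(card_imset _ enum_val_inj); apply: eq_card => v.
  apply/imsetP/idP => [[i + ->]|]; rewrite !inE // => fv.
  by exists (enum_rank v); rewrite ?inE enum_rankK.
have -> : M = \matrix_(i, j) ((i == j)%:R * d (f (enum_val i))
    + (\matrix_(p, q) (eps * (p != q)%:R)) (f (enum_val i)) (f (enum_val j))).
  by apply/matrixP => i j; rewrite defM !mxE ef.
rewrite (spectrum_blockwise_constant _ _ (f \o enum_val) d _ s F) /=.
  by congr (_ + _); apply: eq_bigr => p _; rewrite nf'.
rewrite -Hs; congr char_poly; apply/matrixP => p q; rewrite !mxE.
by rewrite nf'.
Qed.

Lemma char_poly_lumped2 (R : comNzRingType) (d : nat -> R) (n : nat -> nat)
    (eps : R) :
  char_poly (\matrix_(p < 2, q < 2)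
      ((p == q)%:R * d p + eps * (p != q)%:R * (n q)%:R))
  = ('X - (d 0%N)%:P) * ('X - (d 1%N)%:P)
    - (eps ^+ 2 * (n 0%N)%:R * (n 1%N)%:R)%:P.
Proof.
rewrite /char_poly (expand_det_row _ ord0) !big_ord_recl big_ord0 /cofactor.
rewrite !det_mx11 !mxE -!val_eqE /= /bump /= !(mulr1n, mulr0n).
by ring.
Qed.

Lemma char_poly_lumped3 (R : comNzRingType) (d : nat -> R) (n : nat -> nat)
    (eps : R) :
  char_poly (\matrix_(p < 3, q < 3)
      ((p == q)%:R * d p + eps * (p != q)%:R * (n q)%:R))
  = ('X - (d 0%N)%:P) * ('X - (d 1%N)%:P) * ('X - (d 2%N)%:P)
    - (eps ^+ 2)%:P * ((n 0%N * n 1%N)%:R * ('X - (d 2%N)%:P)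
        + (n 0%N * n 2%N)%:R * ('X - (d 1%N)%:P)
        + (n 1%N * n 2%N)%:R * ('X - (d 0%N)%:P))
    - (2%:R * eps ^+ 3)%:P * (n 0%N * n 1%N * n 2%N)%:R.
Proof.
rewrite /char_poly (expand_det_row _ ord0) !big_ord_recl big_ord0 /cofactor.
rewrite !(expand_det_row _ ord0) !big_ord_recl !big_ord0 /cofactor.
rewrite !det_mx11 !mxE -!val_eqE /= /bump /= !(mulr1n, mulr0n).
by ring.
Qed.

Definition complete_multipartite {T : finType} (e : rel T) k (n : nat -> nat) :=
  exists f : T -> 'I_k, (forall v w, e v w = (f v != f w)) /\
    (forall p : 'I_k, #|[set v | f v == p]| = n p).

Lemma card_multipartite {T : finType} {e : rel T} {k} {n : nat -> nat} :
  complete_multipartite e k n -> #|T| = (\sum_(p < k) n p)%N.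
Proof.
case=> f [_ nf]; rewrite -cardsT -sum1_card (partition_big f predT) //=.
apply: eq_bigr => p _; rewrite -nf -sum1_card.
by apply: eq_bigl => v; rewrite !inE.
Qed.

Lemma adj_sum_multipartite {T : finType} {e : rel T} {k} {n : nat -> nat}
    (s : seq algC) (F : algC -> algC) :
  complete_multipartite e k n ->
  char_poly (\matrix_(p < k, q < k)
      ((p == q)%:R * 0 + 1 * (p != q)%:R * (n q)%:R))
    = \prod_(l <- s) ('X - l%:P) ->
  \sum_(l <- spectrum (adjmx e)) F l
    = \sum_(p < k) ((n p)%:R - 1) * F 0 + \sum_(l <- s) F l.
Proof.
case=> f [ef nf] Hs.
apply: (spectrum_multipartite _ _ _ _ _ (fun=> 0) 1 _ _ _ ef nf _ Hs) => i j.
by rewrite mxE mulr0 add0r mul1r.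
Qed.

Lemma lap_sum_multipartite {T : finType} {e : rel T} {k} {n : nat -> nat}
    (d := fun p => #|T|%:R - (n p)%:R) (s : seq algC) (F : algC -> algC) :
  complete_multipartite e k n ->
  char_poly (\matrix_(p < k, q < k)
      ((p == q)%:R * d p + -1 * (p != q)%:R * (n q)%:R))
    = \prod_(l <- s) ('X - l%:P) ->
  \sum_(l <- spectrum (lapmx e)) F l
    = \sum_(p < k) ((n p)%:R - 1) * F (d p) + \sum_(l <- s) F l.
Proof.
case=> f [ef nf] Hs.
apply: (spectrum_multipartite _ _ _ _ _ (fun p => d p) (-1) _ _ _ ef nf _ Hs).
move=> i j; rewrite !mxE mulN1r; congr (_ * _ - _).
exact: gdeg_multipartite ef nf.
Qed.

Lemma slap_sum_multipartite {T : finType} {e : rel T} {k} {n : nat -> nat}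
    (d := fun p => #|T|%:R - (n p)%:R) (s : seq algC) (F : algC -> algC) :
  complete_multipartite e k n ->
  char_poly (\matrix_(p < k, q < k)
      ((p == q)%:R * d p + 1 * (p != q)%:R * (n q)%:R))
    = \prod_(l <- s) ('X - l%:P) ->
  \sum_(l <- spectrum (slapmx e)) F l
    = \sum_(p < k) ((n p)%:R - 1) * F (d p) + \sum_(l <- s) F l.
Proof.
case=> f [ef nf] Hs.
apply: (spectrum_multipartite _ _ _ _ _ (fun p => d p) 1 _ _ _ ef nf _ Hs).
move=> i j; rewrite !mxE mul1r; congr (_ * _ + _).
exact: gdeg_multipartite ef nf.
Qed.

Lemma prod_XsubC2 (R : nzRingType) (x y : R) :
  \prod_(l <- [:: x; y]) ('X - l%:P) = ('X - x%:P) * ('X - y%:P).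
Proof. by rewrite big_cons big_seq1. Qed.

Lemma energy_bipartite {T : finType} {e : rel T} {n : nat -> nat} :
  complete_multipartite e 2 n ->
  energy e = 2%:R * sqrtC (n 0 * n 1)%:R.
Proof.
move=> Kn; set r := sqrtC _.
have r2 : r ^+ 2 = (n 0 * n 1)%:R by rewrite sqrtCK.
have r0 : 0 <= r by rewrite sqrtC_ge0 ler0n.
rewrite /energy (adj_sum_multipartite [:: r; - r] _ Kn).
  rewrite big1 => [|p _]; last by rewrite normr0 mulr0.
  by rewrite big_cons big_seq1 normrN ger0_norm // add0r mulr_natl mulr2n.
rewrite (char_poly_lumped2 _ (fun=> 0)) prod_XsubC2 expr1n mul1r -natrM -r2.
by ring.
Qed.

Lemma Lenergy_bipartite {T : finType} {e : rel T} {n : nat -> nat}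
    (D := avgdeg e) :
  complete_multipartite e 2 n ->
  Lenergy e = ((n 0)%:R - 1) * `|(n 1)%:R - D| + ((n 1)%:R - 1) * `|(n 0)%:R - D|
                + (`|0 - D| + `|(n 0 + n 1)%:R - D|).
Proof.
move=> Kn; have cT := card_multipartite Kn.
rewrite !big_ord_recl big_ord0 /= /bump /= addn0 in cT.
rewrite /Lenergy (lap_sum_multipartite [:: 0; (n 0 + n 1)%:R] _ Kn).
  rewrite !big_ord_recl big_ord0 big_cons big_seq1 /= /bump /= cT addr0.
  have E0 : (n 0 + n 1)%:R - (n 0)%:R = (n 1)%:R :> algC by rewrite natrD addrC addKr.
  have E1 : (n 0 + n 1)%:R - (n 1)%:R = (n 0)%:R :> algC by rewrite natrD addrK.
  by rewrite E0 E1.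
rewrite (char_poly_lumped2 _ (fun p => #|T|%:R - (n p)%:R)) prod_XsubC2.
by rewrite cT; ring.
Qed.

Lemma Qenergy_bipartite {T : finType} {e : rel T} {n : nat -> nat} :
  complete_multipartite e 2 n -> Qenergy e = Lenergy e.
Proof.
move=> Kn; have cT := card_multipartite Kn.
rewrite !big_ord_recl big_ord0 /= /bump /= addn0 in cT.
rewrite /Lenergy (lap_sum_multipartite [:: 0; (n 0 + n 1)%:R] _ Kn).
  rewrite /Qenergy (slap_sum_multipartite [:: 0; (n 0 + n 1)%:R] _ Kn) //.
  rewrite (char_poly_lumped2 _ (fun p => #|T|%:R - (n p)%:R)) prod_XsubC2.
  by rewrite cT; ring.
rewrite (char_poly_lumped2 _ (fun p => #|T|%:R - (n p)%:R)) prod_XsubC2.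
by rewrite cT; ring.
Qed.

Lemma EK_card (T : finType) : (0 < #|T|)%N -> EK T = 2%:R * (#|T|%:R - 1).
Proof. by move=> T0; rewrite /EK -subn1 natrB. Qed.

(* In the graph of the theorem, [m = 2 * u + 3] and [z] is the order of the center. *)
Lemma Lenergy_bipartite_gap {T : finType} {e : rel T} {u z : nat} :
  (0 < z)%N ->
  complete_multipartite e 2 (nth 0%N [:: u.+1 * z; z]%N) ->
  Lenergy e - EK T
    = ((2 * u * u.+1 * z ^ 2 + 2 * u.+2)%:R - (u * u.+2 * z + u.+2 ^ 2 * z)%:R)
      / u.+2%:R.
Proof.
move=> z0 Kn; have cT := card_multipartite Kn.
rewrite !big_ord_recl big_ord0 /= /bump /= addn0 in cT.
have avg : avgdeg e = (2 * u.+1 * z)%:R / u.+2%:R.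
  case: (Kn) => f [ef nf].
  rewrite (avgdeg_multipartite _ _ _ f (fun p => nth 0%N [:: u.+1 * z; z]%N p)) //.
  rewrite !big_ord_recl big_ord0 /= /bump /= cT; field.
  by rewrite !nat1r -!natrM -!natrD !pnatr_eq0; lia.
have u2 : 2%:R + u%:R != 0 :> algC by rewrite -natrD pnatr_eq0.
have d0 : (u.+1 * z)%:R - avgdeg e = (u.+1 * z * u)%:R / u.+2%:R.
  by rewrite avg; field; exact: u2.
have d1 : z%:R - avgdeg e = - ((z * u)%:R / u.+2%:R).
  by rewrite avg; field; exact: u2.
have dN : (u.+1 * z + z)%:R - avgdeg e = (z * (u ^ 2 + 2 * u + 2))%:R / u.+2%:R.
  by rewrite avg; field; exact: u2.
rewrite EK_card ?cT ?(Lenergy_bipartite Kn) /=; last by lia.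
rewrite d0 d1 dN avg sub0r !normrN !ger0_norm ?divr_ge0 ?ler0n //.
by field; exact: u2.
Qed.

Lemma prod_XsubC3 (R : nzRingType) (x y z : R) :
  \prod_(l <- [:: x; y; z]) ('X - l%:P)
  = ('X - x%:P) * (('X - y%:P) * ('X - z%:P)).
Proof. by rewrite !big_cons big_nil mulr1. Qed.

Lemma sum_multipartite3 (n : nat -> nat) (F : nat -> algC) :
  \sum_(p < 3) ((n p)%:R - 1) * F p
  = ((n 0)%:R - 1) * F 0 + (((n 1)%:R - 1) * F 1 + ((n 2)%:R - 1) * F 2).
Proof. by rewrite !big_ord_recl big_ord0 /= /bump /= addr0. Qed.

(* In the graph of the theorem, [m = v + 4] and the center has order [2 * c]. *)
Lemma card_tripartite {T : finType} {e : rel T} {v c : nat} :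
  complete_multipartite e 3 (nth 0%N [:: v.+3 * c; c; c]%N) ->
  #|T| = ((v + 5) * c)%N.
Proof.
move/card_multipartite => ->; rewrite !big_ord_recl big_ord0 /= /bump /=.
by lia.
Qed.

Lemma avgdeg_tripartite {T : finType} {e : rel T} {v c : nat} :
  (0 < c)%N ->
  complete_multipartite e 3 (nth 0%N [:: v.+3 * c; c; c]%N) ->
  avgdeg e = (2 * (2 * v + 7) * c)%:R / (v + 5)%:R.
Proof.
move=> c0 Kn; have cT := card_tripartite Kn; case: Kn => f [ef nf].
rewrite (avgdeg_multipartite _ _ _ f (fun p => nth 0%N [:: v.+3 * c; c; c]%N p)) //.
rewrite !big_ord_recl big_ord0 /= /bump /= cT; field.
by rewrite -natrD !pnatr_eq0; lia.
Qed.

Lemma sqrtC_le_nat (a b : nat) : (a <= b ^ 2)%N -> sqrtC a%:R <= b%:R :> algC.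
Proof.
move=> ab; rewrite -(@ler_pXn2r _ 2) ?nnegrE ?sqrtC_ge0 ?ler0n //.
by rewrite sqrtCK -natrX ler_nat.
Qed.

Lemma sqrtC_ge_nat (a b : nat) : (b ^ 2 <= a)%N -> b%:R <= sqrtC a%:R :> algC.
Proof.
move=> ab; rewrite -(@ler_pXn2r _ 2) ?nnegrE ?sqrtC_ge0 ?ler0n //.
by rewrite sqrtCK -natrX ler_nat.
Qed.

Lemma energy_tripartite {T : finType} {e : rel T} {v c : nat} :
  complete_multipartite e 3 (nth 0%N [:: v.+3 * c; c; c]%N) ->
  energy e = c%:R * (1 + sqrtC (8 * v + 25)%:R).
Proof.
move=> Kn; set t := sqrtC _.
have t2 : t ^+ 2 = (8 * v + 25)%:R by rewrite sqrtCK.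
have t1 : 1 <= t by apply: (sqrtC_ge_nat _ 1); lia.
have c0 : 0 <= c%:R :> algC by rewrite ler0n.
pose h := c%:R * (1 + t) / 2%:R.
pose h' := c%:R * (t - 1) / 2%:R.
have hh : h * h' = (2 * v.+3 * c ^ 2)%:R.
  transitivity (c%:R ^+ 2 * (t ^+ 2 - 1) / 4%:R); first by rewrite /h /h'; field.
  by rewrite t2; field.
have h'E : h' = h - c%:R by rewrite /h /h'; field.
have h0 : 0 <= h by rewrite !mulr_ge0 ?invr_ge0 ?ler0n // addr_ge0 // (le_trans ler01).
have h'0 : 0 <= h' by rewrite !mulr_ge0 ?invr_ge0 ?ler0n // subr_ge0.
rewrite /energy (adj_sum_multipartite [:: - c%:R; h; - h'] _ Kn).
  rewrite big1 => [|p _]; last by rewrite normr0 mulr0.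
  by rewrite !big_cons big_nil /= !normrN !ger0_norm // /h /h'; field.
rewrite (char_poly_lumped3 _ (fun=> 0) (nth 0%N [:: v.+3 * c; c; c]%N)) prod_XsubC3 /=.
have hP : h%:P * h'%:P = (2 * v.+3 * c ^ 2)%:R :> {poly algC}.
  by rewrite -polyCM hh polyC_natr.
have h'P : h'%:P = h%:P - c%:R :> {poly algC} by rewrite h'E polyCB polyC_natr.
transitivity (('X + c%:R) * ('X ^+ 2 - c%:R * 'X - (2 * v.+3 * c ^ 2)%:R) : {poly algC}).
  by ring.
by rewrite -hP !polyCN h'P; ring.
Qed.

Lemma Lenergy_tripartite_gap {T : finType} {e : rel T} {v c : nat} :
  (0 < c)%N ->
  complete_multipartite e 3 (nth 0%N [:: v.+3 * c; c; c]%N) ->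
  Lenergy e - EK T
    = ((2 * (2 * v + 7) * c + 2 * c * (v ^ 2 + 6 * v + 11)
        + 4 * (v + 3) * (v + 2) * c ^ 2 + 2 * (v + 5))%:R
       - (2 * c * (v + 2) * (v + 4) + 2 * (v + 5) ^ 2 * c)%:R) / (v + 5)%:R.
Proof.
move=> c0 Kn; have cT := card_tripartite Kn; have avg := avgdeg_tripartite c0 Kn.
have u2 : v%:R + 5%:R != 0 :> algC by rewrite -natrD pnatr_eq0; lia.
have d0 : #|T|%:R - (v.+3 * c)%:R - avgdeg e = - ((2 * c * (v + 2))%:R / (v + 5)%:R).
  by rewrite avg cT; field; exact: u2.
have d1 : #|T|%:R - c%:R - avgdeg e = ((c * v.+3 * (v + 2)))%:R / (v + 5)%:R.
  by rewrite avg cT; field; exact: u2.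
have dN : #|T|%:R - avgdeg e = (c * (v ^ 2 + 6 * v + 11))%:R / (v + 5)%:R.
  by rewrite avg cT; field; exact: u2.
rewrite EK_card ?cT; last by lia.
rewrite /Lenergy (lap_sum_multipartite [:: 0; #|T|%:R; #|T|%:R] _ Kn); last first.
  rewrite (char_poly_lumped3 _ (fun p => #|T|%:R - (nth 0%N [:: v.+3 * c; c; c]%N p)%:R)
    (nth 0%N [:: v.+3 * c; c; c]%N)).
  rewrite prod_XsubC3 cT /=; ring.
rewrite (sum_multipartite3 (nth 0%N [:: v.+3 * c; c; c]%N)
  (fun p => `|_ - (nth 0%N [:: v.+3 * c; c; c]%N p)%:R - _|)).
rewrite !big_cons big_nil /= d0 d1 dN avg sub0r !normrN.
rewrite !ger0_norm ?divr_ge0 ?ler0n //.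
by field; exact: u2.
Qed.

Lemma Qenergy_tripartite_gap {T : finType} {e : rel T} {v c : nat}
    (s := sqrtC ((v + 3) * (v + 11))%:R) :
  (0 < c)%N ->
  complete_multipartite e 3 (nth 0%N [:: v.+3 * c; c; c]%N) ->
  Qenergy e - EK T
    = ((4 * (v + 3) * (v + 2) * c ^ 2 + c * (v ^ 2 + 4 * v + 1)
        + 2 * (v + 5))%:R + (c * (v + 5))%:R * s
       - (2 * c * (v + 2) * (v + 4) + 2 * (v + 5) ^ 2 * c)%:R) / (v + 5)%:R.
Proof.
move=> c0 Kn; have cT := card_tripartite Kn; have avg := avgdeg_tripartite c0 Kn.
have u2 : v%:R + 5%:R != 0 :> algC by rewrite -natrD pnatr_eq0; lia.
have s2 : s ^+ 2 = ((v + 3) * (v + 11))%:R by rewrite sqrtCK.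
have s5 : (v + 5)%:R <= s by apply: sqrtC_ge_nat; nia.
pose U : algC := (c * (v ^ 2 + 4 * v + 7))%:R / (2 * (v + 5))%:R.
pose V : algC := c%:R * s / 2%:R.
pose h := avgdeg e + U + V.
pose h' := avgdeg e + U - V.
have V0 : 0 <= V by rewrite !mulr_ge0 ?invr_ge0 ?ler0n // (le_trans _ s5) ?ler0n.
have U0 : 0 <= U by rewrite divr_ge0 ?ler0n.
have UV : U <= V.
  apply: (@le_trans _ _ (c%:R * (v + 5)%:R / 2%:R)); last first.
    by rewrite ler_wpM2r ?invr_ge0 ?ler0n // ler_wpM2l ?ler0n.
  rewrite -subr_ge0.
  have -> : c%:R * (v + 5)%:R / 2%:R - U
      = (c * (6 * v + 18))%:R / (2 * (v + 5))%:R :> algC.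
    by rewrite /U; field; exact: u2.
  by rewrite divr_ge0 ?ler0n.
have hp : h + h' = (c * (v + 7))%:R.
  by rewrite /h /h' avg /U; field; exact: u2.
have hh : h * h' = (4 * c ^ 2)%:R.
  transitivity ((avgdeg e + U) ^+ 2 - c%:R ^+ 2 * s ^+ 2 / 4%:R).
    by rewrite /h /h' /V; field.
  by rewrite s2 avg /U; field; exact: u2.
have d0 : #|T|%:R - (v.+3 * c)%:R - avgdeg e = - ((2 * c * (v + 2))%:R / (v + 5)%:R).
  by rewrite avg cT; field; exact: u2.
have d1 : #|T|%:R - c%:R - avgdeg e = ((c * v.+3 * (v + 2)))%:R / (v + 5)%:R.
  by rewrite avg cT; field; exact: u2.
have dq : (v.+3 * c)%:R - avgdeg e = (c * (v ^ 2 + 4 * v + 1))%:R / (v + 5)%:R.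
  by rewrite avg; field; exact: u2.
rewrite EK_card ?cT; last by lia.
rewrite /Qenergy (slap_sum_multipartite [:: (v.+3 * c)%:R; h; h'] _ Kn); last first.
  rewrite (char_poly_lumped3 _ (fun p => #|T|%:R - (nth 0%N [:: v.+3 * c; c; c]%N p)%:R)
    (nth 0%N [:: v.+3 * c; c; c]%N)).
  rewrite prod_XsubC3 cT /=.
  have hP : h%:P * h'%:P = (4 * c ^ 2)%:R :> {poly algC}.
    by rewrite -polyCM hh polyC_natr.
  have h'P : h'%:P = (c * (v + 7))%:R - h%:P :> {poly algC}.
    by rewrite -polyC_natr -hp -polyCB addrAC subrr add0r.
  transitivity (('X - (v.+3 * c)%:R)
      * ('X ^+ 2 - (c * (v + 7))%:R * 'X + (4 * c ^ 2)%:R) : {poly algC}).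
    by ring.
  by rewrite -hP h'P; ring.
rewrite (sum_multipartite3 (nth 0%N [:: v.+3 * c; c; c]%N)
  (fun p => `|_ - (nth 0%N [:: v.+3 * c; c; c]%N p)%:R - _|)).
rewrite !big_cons big_nil /= d0 d1 dq normrN.
have -> : h - avgdeg e = U + V by rewrite /h; ring.
have -> : h' - avgdeg e = - (V - U) by rewrite /h'; ring.
rewrite normrN !ger0_norm ?divr_ge0 ?ler0n ?subr_ge0 ?addr_ge0 //.
by rewrite /V; field; exact: u2.
Qed.

Lemma energy_bipartite_le {T : finType} {e : rel T} {u z : nat} :
  (0 < z)%N ->
  complete_multipartite e 2 (nth 0%N [:: u.+1 * z; z]%N) ->
  energy e <= EK T.
Proof.
move=> z0 Kn; rewrite (energy_bipartite Kn) /EK ler_wpM2l ?ler0n //.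
rewrite (card_multipartite Kn) !big_ord_recl big_ord0 /= /bump /=.
by apply: sqrtC_le_nat; nia.
Qed.

Lemma Lenergy_bipartite_gt {T : finType} {e : rel T} {u z : nat} :
  (0 < z)%N ->
  complete_multipartite e 2 (nth 0%N [:: u.+1 * z; z]%N) ->
  (EK T < Lenergy e) = ~~ [|| z == 1%N, u == 0%N | (u == 1%N) && (z == 2%N)].
Proof.
move=> z0 Kn; rewrite -subr_gt0 (Lenergy_bipartite_gap z0 Kn).
rewrite pmulr_lgt0 ?invr_gt0 ?ltr0n // subr_gt0 ltr_nat.
have [->|z1] := eqVneq z 1%N; first by apply/negbTE; nia.
have [->|u0] := eqVneq u 0%N; first by apply/negbTE; nia.
have [->|u1] := eqVneq u 1%N; last by nia.
have [->|z2] := eqVneq z 2%N; first by [].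
by nia.
Qed.

Lemma energy_tripartite_le {T : finType} {e : rel T} {v c : nat} :
  (0 < c)%N ->
  complete_multipartite e 3 (nth 0%N [:: v.+3 * c; c; c]%N) ->
  energy e <= EK T.
Proof.
move=> c0 Kn; rewrite (energy_tripartite Kn).
apply: (@le_trans _ _ (c%:R * (1 + (2 * v + 7))%:R)).
  rewrite ler_wpM2l ?ler0n // (natrD _ 1) lerD2l.
  by apply: sqrtC_le_nat; nia.
by rewrite /EK -!natrM ler_nat (card_tripartite Kn); nia.
Qed.

Lemma Lenergy_tripartite_gt {T : finType} {e : rel T} {v c : nat} :
  (0 < c)%N ->
  complete_multipartite e 3 (nth 0%N [:: v.+3 * c; c; c]%N) ->
  EK T < Lenergy e.
Proof.
move=> c0 Kn; rewrite -subr_gt0 (Lenergy_tripartite_gap c0 Kn).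
by rewrite pmulr_lgt0 ?invr_gt0 ?ltr0n ?subr_gt0 ?ltr_nat; nia.
Qed.

Lemma Qenergy_tripartite_gt {T : finType} {e : rel T} {v c : nat} :
  (0 < c)%N -> ~~ odd v ->
  complete_multipartite e 3 (nth 0%N [:: v.+3 * c; c; c]%N) ->
  (EK T < Qenergy e) = ~~ ((v == 0%N) && (c == 1%N)).
Proof.
move=> c0 vev Kn; rewrite -subr_gt0 (Qenergy_tripartite_gap c0 Kn).
have v5 : 0 < (v + 5)%:R :> algC by rewrite ltr0n; lia.
rewrite pmulr_lgt0 ?invr_gt0 // subr_gt0.
(* The square root [s = sqrtC ((v + 3) * (v + 11))] is at least [v + 5], which
   settles every case except [v = 0], [c = 1], where [s <= 6] is enough. *)
have [/andP[/eqP-> /eqP->]|ex] /= := boolP (_ && _).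
  apply/negbTE; rewrite -real_leNgt ?realD ?realM ?realn ?sqrtC_real ?ler0n //.
  rewrite -lerBrDl -natrB //.
  apply: (@le_trans _ _ (5%:R * 6%:R)); last by rewrite -natrM ler_nat.
  by rewrite ler_wpM2l ?ler0n //; apply: sqrtC_le_nat.
apply: (@lt_le_trans _ _ ((4 * (v + 3) * (v + 2) * c ^ 2
    + c * (v ^ 2 + 4 * v + 1) + 2 * (v + 5)) + c * (v + 5) * (v + 5))%:R).
  rewrite ltr_nat.
  have [c1|c2] : c = 1%N \/ (1 < c)%N by lia.
    by rewrite c1 andbT in ex *; case: v vev ex {Kn v5} => [|[|v]] //= _ _; nia.
  by nia.
by rewrite natrD natrM lerD2l ler_wpM2l ?ler0n //; apply: sqrtC_ge_nat; nia.
Qed.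

Lemma dihedral_presentation (rT : finGroupType) (H : {group rT}) (m : nat) :
  (1 < m)%N ->
  (H \isog Grp (x : y : (x ^+ m = 1, y ^+ 2 = 1, y * x * y^-1 = x^-1)))%g ->
  exists x y : rT, [/\ H = <[x]> <*> <[y]> :> {set rT}, x ^+ m = 1, y ^+ 2 = 1,
    x ^ y = x^-1 & #|H| = (2 * m)%N]%g.
Proof.
move=> m1 isoH.
have Dhom (aT : finGroupType) (K : {group aT}) : (K \homg H)%g =
    (K \homg [set: 'D_m.*2])%g.
  rewrite isoH (Grp_dihedral m1) /=; apply: eq_existsb => -[x y] /=.
  rewrite !xpair_eqE; congr (_ && _); congr (_ && (_ && _)).
  have -> : (y * x * y^-1 = x ^ y^-1)%g by rewrite conjgE invgK mulgA.
  by rewrite -(inj_eq (conjg_inj y)) conjgKV conjVg eq_sym eq_invg_sym.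
have HD : (H \homg [set: 'D_m.*2])%g by rewrite -Dhom homg_refl.
have := HD; rewrite (Grp_dihedral m1) => /existsP[[x y] /= /eqP[HE xm y2 xy]].
exists x, y; split=> //.
apply/eqP; rewrite mul2n -(card_dihedral m1) eqn_dvd.
by rewrite (card_homg HD) card_homg // Dhom homg_refl.
Qed.

Lemma mem_mul_index2 (gT : finGroupType) (H K : {group gT}) a b :
  H \subset K -> #|K| = (2 * #|H|)%N ->
  a \in K :\: H -> b \in K :\: H -> (a^-1 * b)%g \in H.
Proof.
move=> sHK cK aK bK; rewrite -mem_lcoset; suff -> : (a *: H)%g = K :\: H by [].
apply/eqP; rewrite eqEcard card_lcoset cardsD (setIidPr sHK) cK; apply/andP; split.
  case/setDP: aK => aK aH; apply/subsetP => _ /lcosetP[h hH ->].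
  by rewrite inE groupMr // aH groupM // (subsetP sHK).
by rewrite mul2n -addnn addnK.
Qed.

Section Dihedral.
Local Open Scope group_scope.

Lemma dihedral_structure (rT : finGroupType) (H : {group rT}) (m : nat) (x y : rT) :
  (0 < m)%N ->
  H = <[x]> <*> <[y]> :> {set rT} -> x ^+ m = 1 -> y ^+ 2 = 1 -> x ^ y = x^-1 ->
  #|H| = (2 * m)%N ->
  [/\ #[x] = m, x \in H, y \in H, y \notin <[x]>
    & forall w u, w \in H :\: <[x]> -> u \in <[x]> -> u ^ w = u^-1].
Proof.
move=> m0 HE xm y2 xy cH.
have xH : x \in H by rewrite HE mem_gen // inE cycle_id.
have yH : y \in H by rewrite HE mem_gen // inE cycle_id orbT.
have nXy : <[y]> \subset 'N(<[x]>).
  rewrite cycle_subG inE -cycleJ xy cycleV; exact: subxx.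
have om : (#[x] <= m)%N by rewrite dvdn_leq // order_dvdn xm.
have oy : (#[y] <= 2)%N by rewrite dvdn_leq // order_dvdn y2.
have := mul_cardG <[x]> <[y]>; rewrite -(norm_joinEr nXy) -HE cH -!orderE /= => cXY.
have I0 := cardG_gt0 (<[x]> :&: <[y]>); rewrite /= in I0.
have I1 : #|<[x]> :&: <[y]>| = 1%N.
  apply/eqP; rewrite eqn_leq I0 andbT -(@leq_pmul2l (2 * m)) ?muln_gt0 ?m0 //.
  by rewrite -cXY muln1 (mulnC 2) leq_mul.
rewrite I1 muln1 in cXY.
have ox : #[x] = m.
  by apply/eqP; rewrite eqn_leq om -(@leq_pmul2l 2) // -cXY mulnC leq_mul.
have oy2 : #[y] = 2 by apply/eqP; rewrite -(eqn_pmul2l m0) -{1}ox cXY mulnC.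
have yX : y \notin <[x]>.
  apply/negP => yX; move: I1; rewrite (setIidPr _) ?cycle_subG // -orderE oy2.
  by [].
split=> // w u wH uX.
have yD : y \in H :\: <[x]> by rewrite inE yX yH.
have sXH : <[x]> \subset H by rewrite cycle_subG.
have ywX : y^-1 * w \in <[x]>.
  by apply: (mem_mul_index2 _ _ H y w) => //; rewrite cH -orderE ox.
have cu : u ^ (y^-1 * w) = u.
  by apply/conjg_fixP/commgP; apply: (centsP (cycle_abelian x)).
case/cycleP: uX cu => i ->; rewrite conjgM => cu.
have xVy : (x ^+ i) ^ y^-1 = (x ^+ i)^-1.
  by apply: (canLR (conjgK y)); rewrite conjVg conjXg xy expgVn invgK.
by apply: invg_inj; rewrite invgK -conjVg -xVy.
Qed.

(* If [w] inverts [u] then [w ^ u = w * u ^+ 2]. *)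
Lemma class_dihedral (rT : finGroupType) (H : {group rT}) (x w : rT) :
  x \in H -> #|H| = (2 * #[x])%N -> w \in H :\: <[x]> ->
  (forall u, u \in <[x]> -> u ^ w = u^-1) ->
  w ^: H = w *: <[x ^+ 2]>.
Proof.
move=> xH cH wD inv; have sXH : <[x]> \subset H by rewrite cycle_subG.
have wE u : u \in <[x]> -> w ^ u = w * u ^+ 2.
  move=> uX; have := inv _ (groupVr uX); rewrite invgK => uw.
  by rewrite conjgE mulgA (conjgC _ w) uw expgS expg1 mulgA.
apply/setP => g; rewrite mem_lcoset; apply/imsetP/idP => [[h hH ->]|].
  have [u uX ->] : exists2 u, u \in <[x]> & w ^ h = w ^ u.
    have [hX|hX] := boolP (h \in <[x]>); first by exists h.
    exists (w^-1 * h); last by rewrite conjgM [w ^ w^-1]conjgE mulgV mulg1 invgK.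
    by apply: (mem_mul_index2 _ _ H) => //; rewrite inE hX.
  rewrite wE // mulKg; case/cycleP: uX => i ->.
  by rewrite -expgM mulnC expgM mem_cycle.
case/cycleP => i gE; exists (x ^+ i); first by rewrite groupX.
by rewrite wE ?mem_cycle // -expgM mulnC expgM -gE mulKVg.
Qed.

End Dihedral.

Section AbelianIndex2.
Local Open Scope group_scope.

Lemma cent_index2 {gT : finGroupType} {G A : {group gT}} :
  A \subset G -> abelian A -> #|G| = (2 * #|A|)%N ->
  forall a g, a \in A -> g \in G :\: A -> commute g a -> a \in 'Z(G).
Proof.
move=> sAG abA cG a g aA gGA cga; apply/centerP; split.
  exact: (subsetP sAG).
move=> h hG; have [hA|hA] := boolP (h \in A); first exact: (centsP abA).
have ghA : g^-1 * h \in A by apply: mem_mul_index2 sAG cG gGA _; rewrite inE hA.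
rewrite -(mulKVg g h); apply: commuteM; first exact: commute_sym.
exact: (centsP abA).
Qed.

Lemma card_class_abelian_index2 {gT : finGroupType} {G A : {group gT}} :
  A \subset G -> abelian A -> #|G| = (2 * #|A|)%N ->
  forall a, a \in A :\: 'Z(G) -> #|a ^: G| = 2.
Proof.
move=> sAG abA cG a /setDP[aA aZ].
have CE : 'C_G[a] = A.
  apply/setP => c; rewrite inE; apply/andP/idP => [[cG' /cent1P ca]|cA].
    apply: contraR aZ => cA; apply: (cent_index2 sAG abA cG _ c) => //.
    by rewrite inE cA.
  by rewrite (subsetP sAG) //; split=> //; apply/cent1P; apply: (centsP abA).
by rewrite -index_cent1 CE -divgS // cG mulnK.
Qed.

Lemma card_class_compl_index2 {gT : finGroupType} {G A : {group gT}} :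
  A \subset G -> abelian A -> 'Z(G) \subset A -> #|G| = (2 * #|A|)%N ->
  forall g, g \in G :\: A -> (#|g ^: G| * #|'Z(G)| = #|A|)%N.
Proof.
move=> sAG abA sZA cG g gGA; have /setDP[gG gA] := gGA.
have CI : 'C_G[g] :&: A = 'Z(G).
  apply/setP => c; rewrite in_setI [c \in 'C_G[g]]in_setI.
  apply/andP/idP => [[/andP[cG' /cent1P cg] cA]|cZ].
    exact: (cent_index2 sAG abA cG c g cA gGA (commute_sym cg)).
  rewrite (subsetP sZA) //; split=> //; case/centerP: cZ => cG' cc.
  by rewrite cG' /=; apply/cent1P; apply: cc.
have CD : 'C_G[g] :\: A = g *: 'Z(G).
  apply/setP => c; rewrite mem_lcoset in_setD in_setI.
  apply/andP/idP => [[cA /andP[cG' /cent1P cg]]|cZ].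
    apply: (cent_index2 sAG abA cG _ g _ gGA).
      by apply: (mem_mul_index2 _ _ G) => //; rewrite inE cA.
    by apply: commuteM; [apply/commuteV | apply/commute_sym].
  rewrite -(mulKVg g c) groupMr; last exact: (subsetP sZA).
  split=> //.
  case/centerP: (cZ) => cG' cc; rewrite groupM //=.
  by apply/cent1P/commute_sym/commuteM => //; apply/commute_sym/cc.
have cC : #|'C_G[g]| = (2 * #|'Z(G)|)%N.
  by rewrite -(cardsID A) CI CD card_lcoset mul2n addnn.
have := Lagrange (subsetIl G 'C[g]); rewrite index_cent1 cC cG.
by rewrite -mulnA mulnC => /eqP; rewrite mulnC eqn_pmul2l // mulnC => /eqP.
Qed.

End AbelianIndex2.

Section NCCCGraph.
Local Open Scope group_scope.

Lemma nccc_vertexP {gT : finGroupType} {G : {group gT}} (C : nccc_vertex G) g :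
  g \in val C -> g \in G :\: 'Z(G) /\ val C = g ^: G.
Proof.
case: C => C /= CV; move: (CV); rewrite inE.
case/existsP => x /andP[/setDP[xG xZ] /eqP ->] /imsetP[h hG ->].
split; last by rewrite classGidl.
rewrite in_setD (groupJ xG hG) andbT memJ_norm //.
exact: (subsetP (normal_norm (center_normal G))).
Qed.

Lemma nccc_repr {gT : finGroupType} {G : {group gT}} (C : nccc_vertex G) :
  repr (val C) \in val C.
Proof.
case: C => C /= CV; move: (CV); rewrite inE => /existsP[x /andP[xG /eqP ->]].
exact: mem_repr (class_refl G x).
Qed.

Lemma card_nccc_fiber {gT : finGroupType} {G : {group gT}} {T : eqType}
    (P : gT -> T) (p : T) (r : nat) :
  (forall g h, g \in G :\: 'Z(G) -> h \in G -> P (g ^ h) = P g) ->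
  (forall g, g \in G :\: 'Z(G) -> P g = p -> #|g ^: G| = r) ->
  (#|[set C : nccc_vertex G | P (repr (val C)) == p]| * r
    = #|[set g in G :\: 'Z(G) | P g == p]|)%N.
Proof.
move=> PJ cP; set F := [set C | _].
have PC (C : nccc_vertex G) g : g \in val C -> P (repr (val C)) = P g.
  move=> gC; have [gGZ CE] := nccc_vertexP C g gC.
  have := nccc_repr C; rewrite {2}CE => /imsetP[h hG ->].
  exact: PJ.
rewrite -(card_imset _ val_inj); symmetry; apply: card_uniform_partition.
  move=> _ /imsetP[C CF ->]; have [gGZ ->] := nccc_vertexP C _ (nccc_repr C).
  by apply: cP => //; move: CF; rewrite inE => /eqP.
apply/and3P; split.
- rewrite eqEsubset; apply/andP; split; apply/subsetP => g.
    case/bigcupP => _ /imsetP[C CF ->] gC; have [gGZ _] := nccc_vertexP C g gC.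
    by rewrite inE in CF; rewrite inE gGZ -(PC C).
  rewrite inE => /andP[gGZ Pg].
  have gV : g ^: G \in nccc_vset G.
    by rewrite inE; apply/existsP; exists g; rewrite gGZ /=.
  apply/bigcupP; exists (g ^: G); last exact: class_refl.
  apply/imsetP; exists (Sub (g ^: G) gV); last by rewrite SubK.
  by rewrite inE (PC _ g) // SubK class_refl.
- apply/trivIsetP => _ _ /imsetP[C _ ->] /imsetP[D _ ->].
  apply: contraR => /pred0Pn[g /andP[/= gC gD]].
  by rewrite (nccc_vertexP C g gC).2 (nccc_vertexP D g gD).2.
- apply/imsetP => -[C _ E]; have := nccc_repr C.
  by rewrite -{2}E inE.
Qed.

Lemma nccc_multipartite {gT : finGroupType} {G : {group gT}} {k}
    (P : gT -> 'I_k) (r n : nat -> nat) :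
  (forall g h, g \in G :\: 'Z(G) -> h \in G -> P (g ^ h) = P g) ->
  (forall g h, g \in G :\: 'Z(G) -> h \in G :\: 'Z(G) ->
     P g = P h <-> exists2 a, a \in G & commute g (h ^ a)) ->
  (forall g, g \in G :\: 'Z(G) -> #|g ^: G| = r (P g)) ->
  (forall p : 'I_k, 0 < r p /\
     n p * r p = #|[set g in G :\: 'Z(G) | P g == p]|)%N ->
  complete_multipartite (@nccc_adj gT G) k n.
Proof.
move=> PJ Pcom cP cn; exists (fun C => P (repr (val C))); split=> [C D|p].
  set g := repr (val C); set h := repr (val D).
  have [gGZ CE] := nccc_vertexP C g (nccc_repr C).
  have [hGZ DE] := nccc_vertexP D h (nccc_repr D).
  apply/andP/idP => [[_ /forall_inP CD]|Pgh].
    apply/eqP => /Pcom[] // a aG cga.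
    have /forall_inP/(_ (h ^ a)) := CD _ (nccc_repr C).
    by rewrite DE memJ_class // => /(_ isT); rewrite cga eqxx.
  have Pne x y : x \in val C -> y \in val D -> x * y != y * x.
    rewrite CE DE => /imsetP[a aG ->] /imsetP[b bG ->].
    apply: contraNneq Pgh => cab; apply/eqP/Pcom => //.
    exists (b * a^-1); first by rewrite groupM ?groupV.
    have : commute (g ^ a) (h ^ b) := cab.
    rewrite conjgM /commute => /(congr1 (fun u => u ^ a^-1)).
    by rewrite /= (conjMg (g ^ a)) (conjMg (h ^ b)) conjgK.
  split; last by apply/forall_inP => x xC; apply/forall_inP => y; apply: Pne.
  by apply: contraNneq Pgh => CD; rewrite /g /h CD.
have [r0 np] := cn p; apply/eqP; rewrite -(eqn_pmul2r r0) np.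
by apply/eqP/card_nccc_fiber => // g gGZ Pg; rewrite cP // Pg.
Qed.

End NCCCGraph.

Section CentralQuotientDihedral.
Local Open Scope group_scope.

(* [G] has dihedral central quotient [G / 'Z(G)] with rotation subgroup [<[x]>]
   and reflection [y]; [A] is the preimage of [<[x]>]. *)
Definition dihedral_central_quotient {gT : finGroupType} (G A : {group gT})
    (m : nat) (x y : coset_of 'Z(G)) :=
  [/\ [/\ A \subset G, abelian A, 'Z(G) \subset A, #|A| = (m * #|'Z(G)|)%N
        & #|G| = (2 * #|A|)%N],
      [/\ x \in G / 'Z(G), #[x] = m & y \in G / 'Z(G) :\: <[x]>],
      (forall w, w \in G / 'Z(G) :\: <[x]> ->
        w ^: (G / 'Z(G)) = w *: <[x ^+ 2]>)
    & (forall g, g \in G -> (g \in A) = (coset 'Z(G) g \in <[x]>))].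

Lemma dihedral_central_quotientP {gT : finGroupType} {G : {group gT}} {m : nat} :
  (1 < m)%N ->
  G / 'Z(G) \isog Grp (x : y : (x ^+ m = 1, y ^+ 2 = 1, y * x * y^-1 = x^-1)) ->
  exists A x y, dihedral_central_quotient G A m x y.
Proof.
move=> m1 /(dihedral_presentation _ (G / 'Z(G))%G m m1)[x [y [HE xm y2 xy cH]]].
have m0 := ltnW m1.
have [ox xH yH yX inv] := dihedral_structure _ _ m x y m0 HE xm y2 xy cH.
have nZ : G \subset 'N('Z(G)) := normal_norm (center_normal G).
have sXH : <[x]> \subset G / 'Z(G) by rewrite cycle_subG.
pose A := (coset 'Z(G) @*^-1 <[x]>)%G.
have sZA : 'Z(G) \subset A := sub_cosetpre _.
have sAG : A \subset G by rewrite sub_cosetpre_quo ?center_normal.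
have cA : #|A| = (m * #|'Z(G)|)%N.
  by rewrite card_cosetpre -orderE ox mulnC.
have cG : #|G| = (2 * #|A|)%N.
  by rewrite -(Lagrange (center_sub G)) -card_quotient // cH cA mulnC mulnA.
exists A, x, y; split=> //.
- split=> //; apply: (@cyclic_factor_abelian _ 'Z(G)).
    rewrite subsetI sZA /=; apply: subset_trans (subsetIr _ _) _.
    exact: centS.
  by rewrite cosetpreK cycle_cyclic.
- by split=> //; rewrite inE yX.
- by move=> w wH; apply: class_dihedral => //; rewrite ?cH ?ox // => u; apply: inv.
- by move=> g gG; rewrite /A /= morphpreE in_setI (subsetP nZ) //= inE.
Qed.

Section Structure.
Context {gT : finGroupType} {G A : {group gT}} {m : nat} {x y : coset_of 'Z(G)}.
Context (dihGZ : dihedral_central_quotient G A m x y).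
Local Notation H := (G / 'Z(G)).

Lemma dcq_norm g : g \in G -> g \in 'N('Z(G)).
Proof. exact: (subsetP (normal_norm (center_normal G))). Qed.

Lemma dcq_mem_compl g : g \in G :\: A -> coset 'Z(G) g \in H :\: <[x]>.
Proof.
have [_ _ _ memA] := dihGZ; case/setDP=> gG gA.
by rewrite inE -memA // gA mem_quotient.
Qed.

Lemma dcq_memJ g h : g \in G -> h \in G -> (g ^ h \in A) = (g \in A).
Proof.
have [[sAG _ _ _ cG] _ _ _] := dihGZ => gG hG; rewrite memJ_norm //.
apply: (subsetP (normal_norm (index2_normal sAG _))) => //.
by rewrite -divgS // cG mulnK.
Qed.

Lemma dcq_conj_commute g h :
  g \in G :\: A -> h \in G :\: 'Z(G) ->
  (h \notin A /\ coset 'Z(G) h \in coset 'Z(G) g ^: H)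
  <-> exists2 a, a \in G & commute g (h ^ a).
Proof.
have [[sAG abA sZA _ cG] _ _ memA] := dihGZ.
move=> gGA /setDP[hG hZ]; have /setDP[gG gA] := gGA; split.
  case=> hA /imsetP[_ /morphimP[b nb bG ->]].
  rewrite -morphJ ?dcq_norm // => hgb.
  exists b^-1; first by rewrite groupV.
  have zhg : g^-1 * h ^ b^-1 \in 'Z(G).
    apply: coset_idr; first by rewrite dcq_norm // groupM ?groupJ ?groupV.
    rewrite morphM ?morphV ?dcq_norm ?groupJ ?groupV //.
    rewrite morphJ ?dcq_norm ?groupV //= hgb.
    by rewrite -morphJ ?dcq_norm ?groupJ ?groupV // conjgK mulVg.
  rewrite -(mulKVg g (h ^ b^-1)); apply: commuteM => //.
  by case/centerP: zhg => _ zc; apply/commute_sym/zc.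
case=> a aG cga.
have haA : h ^ a \notin A.
  apply: contra hZ => haA; have := cent_index2 sAG abA cG _ g haA gGA cga.
  by rewrite memJ_norm // dcq_norm.
have zgh : g^-1 * h ^ a \in 'Z(G).
  apply: (cent_index2 sAG abA cG _ g) => //.
    by apply: (mem_mul_index2 _ _ G) => //; rewrite inE haA groupJ.
  by apply: commuteM => //; apply: commuteV.
split; first by rewrite dcq_memJ in haA.
have -> : coset 'Z(G) g = coset 'Z(G) (h ^ a).
  rewrite -[in RHS](mulKVg g (h ^ a)) morphM ?dcq_norm //=.
    by rewrite (coset_id zgh) mulg1.
  by rewrite groupM ?groupV ?groupJ.
rewrite morphJ ?dcq_norm //=; apply/imsetP; exists (coset 'Z(G) a)^-1.
  by rewrite groupV mem_quotient.
by rewrite conjgK.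
Qed.

Lemma dcq_card_class g : g \in G :\: A -> #|g ^: G| = m.
Proof.
have [[sAG abA sZA cA cG] _ _ _] := dihGZ => gGA.
apply/eqP; rewrite -(eqn_pmul2r (cardG_gt0 'Z(G))) -cA.
by rewrite (card_class_compl_index2 sAG abA sZA cG).
Qed.

Lemma dcq_card_rotations : #|A :\: 'Z(G)| = (m.-1 * #|'Z(G)|)%N.
Proof.
have [[_ _ sZA cA _] _ _ _] := dihGZ.
by rewrite cardsD (setIidPr sZA) cA mulnC -subn1 mulnBl mul1n mulnC.
Qed.

Lemma dcq_card_reflections : #|G :\: A| = (m * #|'Z(G)|)%N.
Proof.
have [[sAG _ _ cA cG] _ _ _] := dihGZ.
by rewrite cardsD (setIidPr sAG) cG cA mul2n -addnn addnK.
Qed.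

Lemma dcq_commute g h : g \in G :\: 'Z(G) -> h \in G :\: 'Z(G) ->
  (exists2 a, a \in G & commute g (h ^ a))
  <-> if g \in A then (h \in A : Prop)
      else h \notin A /\ coset 'Z(G) h \in coset 'Z(G) g ^: H.
Proof.
have [[sAG abA _ _ cG] _ _ _] := dihGZ => gGZ hGZ.
have /setDP[gG gZ] := gGZ; have /setDP[hG hZ] := hGZ.
have [gA|gA] := boolP (g \in A); last first.
  by apply: iff_sym; apply: dcq_conj_commute => //; rewrite inE gA.
split=> [[a aG cga]|hA]; last first.
  by exists 1; rewrite ?group1 // conjg1; apply: (centsP abA).
apply: contraR gZ => hA; apply: (cent_index2 sAG abA cG g (h ^ a)) => //.
by rewrite inE dcq_memJ // hA groupJ.
Qed.

Lemma dcq_nccc_odd u : m = (2 * u + 3)%N ->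
  complete_multipartite (@nccc_adj gT G) 2 (nth 0%N [:: u.+1 * #|'Z(G)|; #|'Z(G)|]%N).
Proof.
move=> mE; have [[sAG abA sZA cA cG] [xH ox yH] clE memA] := dihGZ.
pose P g : 'I_2 := if g \in A then ord0 else ord_max.
have PE g h : (P g == P h) = ((g \in A) == (h \in A)).
  by rewrite /P; do 2 case: (_ \in A).
have clX g h : g \in G :\: A -> h \in G :\: A -> coset 'Z(G) h \in coset 'Z(G) g ^: H.
  move=> gGA hGA; rewrite clE ?dcq_mem_compl // mem_lcoset.
  have <- : <[x]> = <[x ^+ 2]>.
    apply/eqP; rewrite -[_ == _]/(generator _ _) generator_coprime ox mE.
    by rewrite coprimen2; lia.
  have /setDP[gG _] := gGA; have /setDP[hG _] := hGA.
  have ghG : g^-1 * h \in G by rewrite groupM ?groupV.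
  rewrite -morphV ?dcq_norm //= -morphM ?dcq_norm ?groupV //= -memA //.
  exact: mem_mul_index2 sAG cG gGA hGA.
apply: (nccc_multipartite P (nth 0%N [:: 2; m]%N)).
- by move=> g h /setDP[gG _] hG; rewrite /P dcq_memJ.
- move=> g h gGZ hGZ; apply: iff_trans (iff_sym (dcq_commute _ _ gGZ hGZ)).
  rewrite (rwP eqP) PE; have /setDP[gG _] := gGZ; have /setDP[hG _] := hGZ.
  have [gA|gA] := boolP (g \in A); first by rewrite eq_sym eqb_id.
  rewrite eq_sym eqbF_neg; split=> [hA|[]] //; split=> //.
  by apply: clX; rewrite inE ?gA ?hA.
- move=> g gGZ; have /setDP[gG gZ] := gGZ; rewrite /P.
  have [gA|gA] := boolP (g \in A).
    by apply: (card_class_abelian_index2 sAG abA cG); rewrite inE gZ.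
  by apply: dcq_card_class; rewrite inE gA.
- case=> -[|[|//]] p2 /=.
    split=> //; transitivity #|A :\: 'Z(G)|.
      rewrite dcq_card_rotations mE mulnAC.
      by have -> : (2 * u + 3).-1 = (u.+1 * 2)%N by lia.
    apply: eq_card => g; rewrite inE !in_setD -val_eqE /P.
    have [gA|gA] /= := boolP (g \in A); last by rewrite !andbF.
    by rewrite (subsetP sAG) // !andbT.
  split; first by lia.
  transitivity #|G :\: A|; first by rewrite dcq_card_reflections mulnC.
  apply: eq_card => g; rewrite inE !in_setD -val_eqE /P.
  have [gA|gA] /= := boolP (g \in A); first by rewrite andbF.
  by rewrite (contraNN (subsetP sZA g) gA) andbT.
Qed.

Lemma dcq_order_square : ~~ odd m -> #[x ^+ 2] = m./2.
Proof.
have [_ [_ ox _] _ _] := dihGZ => mev.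
by rewrite orderXdiv ox ?divn2 // dvdn2.
Qed.

Lemma dcq_card_reflection_class : ~~ odd m ->
  #|[set g in G :\: A | coset 'Z(G) g \in y ^: H]| = (m./2 * #|'Z(G)|)%N.
Proof.
move=> mev; have [[sAG abA sZA cA cG] [xH ox yH] clE memA] := dihGZ.
have /setDP[yG yX] := yH; case/morphimP: yG => g0 ng0 g0G yE.
have gpre h : h \in G ->
    (g0^-1 * h \in (coset 'Z(G) @*^-1 <[x ^+ 2]>)) = (coset 'Z(G) h \in y ^: H).
  move=> hG; rewrite clE // mem_lcoset yE -morphV ?dcq_norm //=.
  rewrite -morphM ?dcq_norm ?groupV //= morphpreE in_setI dcq_norm ?groupM ?groupV //=.
  by rewrite inE.
transitivity #|g0 *: (coset 'Z(G) @*^-1 <[x ^+ 2]>)|.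
  apply: eq_card => h; rewrite inE mem_lcoset; apply/andP/idP => [[]|].
    by case/setDP=> hG hA; rewrite gpre.
  move=> hS; have hG : h \in G.
    rewrite -(mulKVg g0 h) groupM //; apply: subsetP hS.
    by rewrite sub_cosetpre_quo ?center_normal // cycle_subG groupX.
  rewrite gpre // in hS; split=> //; rewrite inE hG andbT memA //.
  apply: contra yX => hX; move: hS; rewrite clE // mem_lcoset => hS.
  rewrite -groupV -(groupMr _ hX); apply: subsetP hS.
  by rewrite cycle_subG mem_cycle.
by rewrite card_lcoset card_cosetpre -orderE dcq_order_square // mulnC.
Qed.

Lemma dcq_nccc_even v : m = (v + 4)%N -> ~~ odd v ->
  exists c, #|'Z(G)| = (2 * c)%N /\
    complete_multipartite (@nccc_adj gT G) 3 (nth 0%N [:: v.+3 * c; c; c]%N).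
Proof.
move=> mE vev; have [[sAG abA sZA cA cG] [xH ox yH] clE memA] := dihGZ.
have mev : ~~ odd m by rewrite mE oddD addbF.
pose o1 : 'I_3 := @Ordinal 3 1 isT.
pose P g : 'I_3 := if g \in A then ord0
                   else if coset 'Z(G) g \in y ^: H then o1 else ord_max.
have PJ g h : g \in G :\: 'Z(G) -> h \in G -> P (g ^ h) = P g.
  move=> /setDP[gG _] hG; rewrite /P dcq_memJ // morphJ ?dcq_norm //=.
  by rewrite memJ_norm // (subsetP (class_norm _ _)) // mem_quotient.
have cls g : g \in G :\: 'Z(G) -> #|g ^: G| = nth 0%N [:: 2; m; m]%N (P g).
  case/setDP=> gG gZ; rewrite /P; have [gA|gA] := boolP (g \in A).
    by apply: (card_class_abelian_index2 sAG abA cG); rewrite inE gZ.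
  by case: ifP => _; apply: dcq_card_class; rewrite inE gA.
have c1 : #|[set g in G :\: 'Z(G) | P g == o1]| = (m./2 * #|'Z(G)|)%N.
  rewrite -dcq_card_reflection_class //; apply: eq_card => g.
  rewrite [LHS]inE [RHS]inE !in_setD -val_eqE /P.
  have [gA|gA] /= := boolP (g \in A); first by rewrite andbF.
  rewrite (contraNN (subsetP sZA g) gA) /=.
  by case: (_ \in y ^: H); rewrite ?andbT ?andbF.
have c2 : #|[set g in G :\: 'Z(G) | P g == ord_max]| = (m./2 * #|'Z(G)|)%N.
  apply/eqP; rewrite -(eqn_add2l (m./2 * #|'Z(G)|)) -mulnDl addnn even_halfK //.
  rewrite -dcq_card_reflections -dcq_card_reflection_class //.
  pose Y := [set g | coset 'Z(G) g \in y ^: H].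
  have YE g : (g \in Y) = (coset 'Z(G) g \in y ^: H) by rewrite inE.
  rewrite -(cardsID Y (G :\: A)).
  apply/eqP; congr (_ + _)%N; apply: eq_card => g.
    by rewrite in_setI YE [LHS]inE.
  rewrite [LHS]inE !in_setD YE -val_eqE /P.
  have [gA|gA] /= := boolP (g \in A); first by rewrite !andbF.
  rewrite (contraNN (subsetP sZA g) gA) /=.
  by case: (_ \in y ^: H); rewrite ?andbT ?andbF.
pose c := #|[set C : nccc_vertex G | P (repr (val C)) == o1]|.
have cm : (c * m)%N = (m./2 * #|'Z(G)|)%N.
  by rewrite -c1; apply: card_nccc_fiber => // g gGZ Pg; rewrite cls // Pg.
have m2 : m = (2 * m./2)%N by rewrite mul2n even_halfK.
have h0 : (0 < m./2)%N by lia.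
have zE : #|'Z(G)| = (2 * c)%N.
  apply/eqP; rewrite -(eqn_pmul2l h0) -cm {1}m2; apply/eqP.
  by rewrite mulnCA mulnA mulnC.
exists c; split=> //; apply: (nccc_multipartite P (nth 0%N [:: 2; m; m]%N)) => //.
  move=> g h gGZ hGZ; apply: iff_trans (iff_sym (dcq_commute _ _ gGZ hGZ)).
  have /setDP[gG _] := gGZ; have /setDP[hG _] := hGZ; rewrite /P.
  have [gA|gA] := boolP (g \in A).
    by case: (h \in A) => //; case: ifP => _; split.
  have [hA|hA] := boolP (h \in A); first by case: ifP => _; split=> // -[].
  have gX : coset 'Z(G) g \in H :\: <[x]> by rewrite dcq_mem_compl // inE gA.
  have hX : coset 'Z(G) h \in H :\: <[x]> by rewrite dcq_mem_compl // inE hA.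
  have [gy|gy] := boolP (coset 'Z(G) g \in y ^: H).
    by rewrite (class_eqP gy); case: ifP => _; split=> // -[].
  have [hy|hy] := boolP (coset 'Z(G) h \in y ^: H).
    split=> // -[_ hg]; case/negP: gy.
    by rewrite -(class_eqP hy) class_sym.
  split=> // _; split=> //; rewrite clE // mem_lcoset.
  have yw w : w \in H :\: <[x]> -> w \notin y ^: H ->
      y^-1 * w \in <[x]> :\: <[x ^+ 2]>.
    move=> wX; rewrite clE // mem_lcoset => wy; rewrite inE wy.
    apply: mem_mul_index2 yH wX; first by rewrite cycle_subG.
    apply/eqP; rewrite -(eqn_pmul2r (cardG_gt0 'Z(G))) mulnC card_quotient.
      by rewrite Lagrange ?center_sub // cG cA -orderE ox mulnA.
    exact: normal_norm (center_normal G).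
  have := mem_mul_index2 _ <[x ^+ 2]> <[x]> _ _ _ _ (yw _ gX gy) (yw _ hX hy).
  rewrite invMg invgK mulgA mulgK; apply; first by rewrite cycle_subG mem_cycle.
  by rewrite -!orderE dcq_order_square // ox.
case=> -[|[|[|//]]] p3; rewrite /=.
- split=> //; transitivity #|A :\: 'Z(G)|.
    rewrite dcq_card_rotations mE zE.
    have -> : (v + 4).-1 = v.+3 by lia.
    by rewrite -mulnA (mulnC c).
  apply: eq_card => g; rewrite inE !in_setD -val_eqE /P.
  have [gA|gA] /= := boolP (g \in A); last by case: ifP; rewrite !andbF.
  by rewrite (subsetP sAG) // !andbT.
- split; first by lia.
  by rewrite cm -c1; apply: eq_card => g; rewrite [LHS]inE [RHS]inE -!val_eqE.
- split; first by lia.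
  by rewrite cm -c2; apply: eq_card => g; rewrite [LHS]inE [RHS]inE -!val_eqE.
Qed.

End Structure.
End CentralQuotientDihedral.

Theorem theorem4p3 (gT : finGroupType) (G : {group gT}) (m : nat) :
  (3 <= m)%N ->
  (G / 'Z(G) \isog Grp (x : y : (x ^+ m = 1, y ^+ 2 = 1, y * x * y^-1 = x^-1)))%g ->
  let z := #|'Z(G)%g| in
  let e := @nccc_adj gT G in
  [/\ (m = 3%N -> z = 1%N -> borderenergetic e),
      ~ hyperenergetic e,
      (m = 3%N -> z = 1%N -> L_borderenergetic e),
      (L_hyperenergetic e <->
         ~ [\/ z = 1%N, m = 3%N | (m = 5%N /\ z = 2%N)]) &
      (m = 3%N -> z = 1%N -> Q_borderenergetic e) /\
      (Q_hyperenergetic e <->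
         ~ [\/ z = 1%N, m = 3%N, (m = 5%N /\ z = 2%N) | (m = 4%N /\ z = 2%N)])].
Proof.
move=> m3 /(dihedral_central_quotientP (ltnW m3))[A [x [y dihGZ]]] z e.
rewrite /hyperenergetic /L_hyperenergetic /Q_hyperenergetic.
have z0 : (0 < z)%N := cardG_gt0 _.
have [mo|me] := boolP (odd m).
  have [u mE] : exists u, m = (2 * u + 3)%N by exists (m - 3)./2; lia.
  have Kn := dcq_nccc_odd dihGZ u mE; rewrite -/z -/e in Kn.
  have Lb : m = 3%N -> z = 1%N -> Lenergy e = EK (nccc_vertex G).
    move=> m3E z1; apply/eqP; rewrite -subr_eq0 (Lenergy_bipartite_gap z0 Kn).
    have [-> ->] : u = 0%N /\ z = 1%N by lia.
    by rewrite -natrB // mul0r.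
  rewrite /Q_borderenergetic (Qenergy_bipartite Kn) (Lenergy_bipartite_gt z0 Kn).
  split=> //; last 2 first.
  - split=> [H|H]; first by case=> [?|?|[? ?]]; lia.
    apply/negP => /or3P[/eqP z1|/eqP u0|/andP[/eqP u1 /eqP z2]]; apply: H.
    + by constructor 1.
    + by constructor 2; lia.
    + by constructor 3; lia.
  - split=> //; split=> [H|H]; first by case=> [?|?|[? ?]|[? ?]]; lia.
    apply/negP => /or3P[/eqP z1|/eqP u0|/andP[/eqP u1 /eqP z2]]; apply: H.
    + by constructor 1.
    + by constructor 2; lia.
    + by constructor 3; lia.
  - move=> m3E z1; rewrite /borderenergetic (energy_bipartite Kn) /EK.
    rewrite (card_multipartite Kn) !big_ord_recl big_ord0 /= /bump /=.
    have [-> ->] : u = 0%N /\ z = 1%N by lia.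
    by rewrite sqrtC1.
  - by rewrite (le_gtF (energy_bipartite_le z0 Kn)).
have [v mE] : exists v, m = (v + 4)%N by exists (m - 4)%N; lia.
have vev : ~~ odd v by lia.
have [c [zE Kn]] := dcq_nccc_even dihGZ v mE vev; rewrite -/z -/e in zE Kn.
have c0 : (0 < c)%N by lia.
rewrite (Lenergy_tripartite_gt c0 Kn) (Qenergy_tripartite_gt c0 vev Kn).
split.
- by lia.
- by rewrite (le_gtF (energy_tripartite_le c0 Kn)).
- by lia.
- by split=> // _ [?|?|[? ?]]; lia.
split; first by lia.
split=> [H|H]; first by case=> [?|?|[? ?]|[? ?]]; lia.
apply/negP => /andP[/eqP v0 /eqP c1]; apply: H.
by constructor 4; lia.
Qed.
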